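(* Consider the leader $v(t+1)=Sv(t)$ and the followers $x_i(t+1)=A_ix_i(t)+B_iu_i(t)+E_iv(t)$, $e_i(t)=C_ix_i(t)+D_iu_i(t)+F_iv(t)$, $i=1,\dots,N$, with communication graph $\bar{\mathcal G}$, as in the context. Assume: (1) all eigenvalues of $S$ have modulus smaller than or equal to $1$; (2) for $i=1,\dots,N$, the pair $(A_i,B_i)$ is stabilizable; (3) for $i=1,\dots,N$, the linear matrix equations $X_iS=A_iX_i+B_iU_i+E_i$, $0=C_iX_i+D_iU_i+F_i$ have a unique solution pair $(X_i,U_i)$, $X_i\in\mathbb R^{n_i\times q}$, $U_i\in\mathbb R^{m_i\times q}$; (4) $\bar{\mathcal G}$ contains a spanning tree with node $0$ as the root. Let $0<\mu_1<\frac{2}{\rho(H)}$, let $\mu_2>0$ be such that $(I_N\otimes S)-\mu_2(H\otimes S)$ is Schur, and let $0<\mu_{3i}<\frac{2}{\rho(Q_i^TQ_i)}$, $i=1,\dots,N$. For each $i$ let $K_{xi}\in\mathbb R^{m_i\times n_i}$ be such that $A_i+B_iK_{xi}$ is Schur. Consider the control law, for $i=1,\dots,N$, $$u_i(t)=K_{xi}x_i(t)+K_{\eta i}(t)\eta_i(t),\qquad K_{\eta i}(t)=\hat U_i(t)-K_{xi}\hat X_i(t),$$ $$S_i(t+1)=S_i(t)+\mu_1\sum_{j=0}^Na_{ij}(S_j(t)-S_i(t)),$$ $$\eta_i(t+1)=S_i(t)\eta_i(t)+\mu_2S_i(t)\sum_{j=0}^Na_{ij}(\eta_j(t)-\eta_i(t)),$$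 $$\zeta_i(t+1)=\zeta_i(t)-\mu_{3i}G_i(t)^T(G_i(t)\zeta_i(t)-b_i),$$ where $S_0(t)=S$, $\eta_0(t)=v(t)$, and $\begin{bmatrix}\hat X_i(t)\\ \hat U_i(t)\end{bmatrix}=M^q_{n_i+m_i}(\zeta_i(t))$ with $\hat X_i(t)\in\mathbb R^{n_i\times q}$, $\hat U_i(t)\in\mathbb R^{m_i\times q}$. Then the trajectory of the closed-loop system starting from any initial state ($v(0)$, $x_i(0)$, $S_i(0)$, $\eta_i(0)$, $\zeta_i(0)$, $i=1,\dots,N$) exists for all $t\ge 0$ and satisfies: (a) when $v$ is bounded, the trajectory of the closed-loop system is bounded for all $t\ge0$; (b) $\lim_{t\to\infty}e_i(t)=0$ for $i=1,\dots,N$.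
   Context: Time $t$ ranges over the nonnegative integers. A square matrix is Schur if all its eigenvalues have modulus less than $1$. For a square matrix $A$ with spectrum $\sigma(A)$, $\rho(A)=\max_{\lambda\in\sigma(A)}\frac{|\lambda|^2}{\mathrm{Re}(\lambda)}$ (this is not the spectral radius in general). $\otimes$ is the Kronecker product. $\mathrm{vec}(A)$ is the column vector obtained by stacking the columns of $A$; for $X=\mathrm{col}(X_1,\dots,X_q)\in\mathbb R^{nq}$ with $X_k\in\mathbb R^n$, $M^q_n(X)=[X_1\ \cdots\ X_q]\in\mathbb R^{n\times q}$. Dimensions: $v\in\mathbb R^q$ (leader state), $S\in\mathbb R^{q\times q}$, $x_i\in\mathbb R^{n_i}$ (state), $u_i\in\mathbb R^{m_i}$ (input), $e_i\in\mathbb R^{m_i}$ (regulated output), and $A_i,B_i,C_i,D_i,E_i,F_i$ are constant real matrices of compatible dimensions. Also $S_i\in\mathbb R^{q\times q}$, $\eta_i\in\mathbb R^q$, $\zeta_i\in\mathbb R^{q(n_i+m_i)}$. Graph: $\bar{\mathcal G}=(\bar{\mathcal V},\bar{\mathcal E})$ is a directed graph with $\bar{\mathcal V}=\{0,1,\dots,N\}$; node $0$ is the leader, node $i$ the $i$th follower; for $i=0,\dots,N$, $j=1,\dots,N$, $(i,j)\in\bar{\mathcal E}$ means agent $j$ can use information of agent $i$. $[a_{ij}]_{i,j=0}^N$ is a weighted adjacency matrix of $\bar{\mathcal G}$: $a_{ii}=0$, $a_{ij}>0$ if $(j,i)\in\bar{\mathcal E}$, and $a_{ij}=0$ otherwise.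 Thus the control law of follower $i$ uses only information of agent $i$ and its neighbors, i.e. it is distributed. A spanning tree rooted at $0$ means that every other node is reachable from $0$ by a directed path. $H=[h_{ij}]\in\mathbb R^{N\times N}$ ($i,j=1,\dots,N$) with $h_{ii}=\sum_{j=0}^Na_{ij}$ and $h_{ij}=-a_{ij}$ for $i\ne j$. For $i=1,\dots,N$: $$b_i=\mathrm{vec}\begin{bmatrix}E_i \\ F_i\end{bmatrix},\quad Q_i=S^T\otimes\begin{bmatrix}I_{n_i}&0 \\ 0&0\end{bmatrix}-I_q\otimes\begin{bmatrix}A_i&B_i \\ C_i&D_i\end{bmatrix},\quad G_i(t)=S_i(t)^T\otimes\begin{bmatrix}I_{n_i}&0 \\ 0&0\end{bmatrix}-I_q\otimes\begin{bmatrix}A_i&B_i \\ C_i&D_i\end{bmatrix}.$$ *)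

(* Defs.v *)
From HB Require Import structures.
From mathcomp Require Import all_boot all_order all_algebra.
From mathcomp Require Import all_classical all_reals all_analysis.
From mathcomp Require Import complex mxtens.

Set Implicit Arguments.
Unset Strict Implicit.
Unset Printing Implicit Defensive.

Import Order.TTheory GRing.Theory Num.Theory.
Import numFieldNormedType.Exports.
Local Open Scope classical_set_scope.
Local Open Scope ring_scope.

(* The spectrum of a real matrix is its set of complex eigenvalues. *)
Definition spectrum (R : realType) (n : nat) (A : 'M[R]_n) : set R[i] :=
  [set l | eigenvalue (map_mx (real_complex R) A) l].

Definition is_Schur (R : realType) (n : nat) (A : 'M[R]_n) : Prop :=
  forall l, spectrum A l -> Normc.normc l < 1.

(* The greatest element of E; the default value 0 is used only if E has none. *)
Definition max_set (R : realType) (E : set R) : R :=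
  xget 0 [set m | E m /\ ubound E m].

(* Not the spectral radius.  The spectrum of a matrix of positive size is finite
   and nonempty, so the maximum then exists. *)
Definition rho (R : realType) (n : nat) (A : 'M[R]_n) : R :=
  max_set [set Normc.normc l ^+ 2 / complex.Re l | l in spectrum A].

Definition stabilizable (R : realType) (n m : nat)
    (A : 'M[R]_n) (B : 'M[R]_(n, m)) : Prop :=
  exists K : 'M[R]_(m, n), is_Schur (A + B *m K).

(* Stacks columns: [mxtens_index (j, i)] is j * n + i, the index order of the
   Kronecker product [_ *t _]. *)
Definition vec (R : realType) (n q : nat) (A : 'M[R]_(n, q)) : 'cV[R]_(q * n) :=
  \col_(k < q * n) A (mxtens_unindex k).2 (mxtens_unindex k).1.

(* M_n^q : the k-th block of n entries of X becomes the k-th column. *)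
Definition unvec (R : realType) (n q : nat) (X : 'cV[R]_(q * n)) : 'M[R]_(n, q) :=
  \matrix_(i < n, j < q) X (mxtens_index (j, i)) 0.

(* The matrix S^T (x) diag(I, 0) - I_q (x) [A, B; C, D], which is Q_i, and also
   G_i(t) when S is replaced by S_i(t). *)
Definition regulator_mx (R : realType) (q n m : nat) (S : 'M[R]_q)
    (A : 'M[R]_n) (B : 'M[R]_(n, m)) (C : 'M[R]_(m, n)) (D : 'M[R]_m) :
    'M[R]_(q * (n + m)) :=
  S^T *t block_mx 1%:M 0 0 0 - 1%:M *t block_mx A B C D.

Definition regulator_rhs (R : realType) (q n m : nat)
    (E : 'M[R]_(n, q)) (F : 'M[R]_(m, q)) : 'cV[R]_(q * (n + m)) :=
  vec (col_mx E F).

(* Node 0 is [ord0] and follower i : 'I_N is the node [lift ord0 i].  The weight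
   a i j belongs to the edge from j to i. *)
Definition weighted_adjacency (R : realType) (N : nat)
    (edge : rel 'I_N.+1) (a : 'M[R]_N.+1) : Prop :=
  [/\ forall i, a i i = 0,
      forall i j, edge j i -> 0 < a i j
    & forall i j, ~~ edge j i -> a i j = 0].

Definition has_spanning_tree_from (N : nat) (edge : rel 'I_N.+1) (r : 'I_N.+1) :
    Prop :=
  forall i, connect edge r i.

Definition Hmx (R : realType) (N : nat) (a : 'M[R]_N.+1) : 'M[R]_N :=
  \matrix_(i < N, j < N)
    if i == j then \sum_(k < N.+1) a (lift ord0 i) k
    else - a (lift ord0 i) (lift ord0 j).

(* Extends a family indexed by the followers by a value at the leader. *)
Definition with_leader (T : Type) (N : nat) (leader : T) (f : 'I_N -> T)
    (j : 'I_N.+1) : T :=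
  if unlift ord0 j is Some k then f k else leader.

Record trajectory (R : realType) (N q : nat) (n m : 'I_N -> nat) := Trajectory {
  tr_v : nat -> 'cV[R]_q;
  tr_x : forall i, nat -> 'cV[R]_(n i);
  tr_u : forall i, nat -> 'cV[R]_(m i);
  tr_e : forall i, nat -> 'cV[R]_(m i);
  tr_S : 'I_N -> nat -> 'M[R]_q;
  tr_eta : 'I_N -> nat -> 'cV[R]_q;
  tr_zeta : forall i, nat -> 'cV[R]_(q * (n i + m i))
}.

Definition plant (R : realType) (N q : nat) (n m : 'I_N -> nat) (S : 'M[R]_q)
    (A : forall i, 'M[R]_(n i)) (B : forall i, 'M[R]_(n i, m i))
    (C : forall i, 'M[R]_(m i, n i)) (D : forall i, 'M[R]_(m i))
    (E : forall i, 'M[R]_(n i, q)) (F : forall i, 'M[R]_(m i, q))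
    (tr : trajectory R q n m) : Prop :=
  let v := tr_v tr in let x := tr_x tr in let u := tr_u tr in
  forall t,
  [/\ v t.+1 = S *m v t,
      forall i, x i t.+1 = A i *m x i t + B i *m u i t + E i *m v t
    & forall i, tr_e tr i t = C i *m x i t + D i *m u i t + F i *m v t].

Definition controller (R : realType) (N q : nat) (n m : 'I_N -> nat) (S : 'M[R]_q)
    (A : forall i, 'M[R]_(n i)) (B : forall i, 'M[R]_(n i, m i))
    (C : forall i, 'M[R]_(m i, n i)) (D : forall i, 'M[R]_(m i))
    (E : forall i, 'M[R]_(n i, q)) (F : forall i, 'M[R]_(m i, q))
    (a : 'M[R]_N.+1) (mu1 mu2 : R) (mu3 : 'I_N -> R)
    (Kx : forall i, 'M[R]_(m i, n i))
    (tr : trajectory R q n m) : Prop :=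
  forall t i,
  let Sh := tr_S tr in let eta := tr_eta tr in
  let zeta := tr_zeta tr i in
  let Sbar j := with_leader S (Sh^~ t) j in
  let etabar j := with_leader (tr_v tr t) (eta^~ t) j in
  let w := a (lift ord0 i) in
  let G := regulator_mx (Sh i t) (A i) (B i) (C i) (D i) in
  let b := regulator_rhs (E i) (F i) in
  let Xh := usubmx (unvec (zeta t)) in
  let Uh := dsubmx (unvec (zeta t)) in
  let Keta := Uh - Kx i *m Xh in
  [/\ tr_u tr i t = Kx i *m tr_x tr i t + Keta *m eta i t,
      Sh i t.+1 = Sh i t + mu1 *: \sum_(j < N.+1) w j *: (Sbar j - Sh i t),
      eta i t.+1 = Sh i t *m eta i t
        + mu2 *: (Sh i t *m \sum_(j < N.+1) w j *: (etabar j - eta i t))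
    & zeta t.+1 = zeta t - mu3 i *: (G^T *m (G *m zeta t - b))].

(* Main.v *)
Require Import Defs.
From HB Require Import structures.
From mathcomp Require Import all_boot all_order all_algebra.
From mathcomp Require Import all_classical all_reals all_analysis.
From mathcomp Require Import complex mxtens.
From mathcomp Require Import ring lra.

Set Implicit Arguments.
Unset Strict Implicit.
Unset Printing Implicit Defensive.

Import Order.TTheory GRing.Theory Num.Theory.
Import numFieldNormedType.Exports.
Local Open Scope classical_set_scope.
Local Open Scope ring_scope.

(* All error signals of the closed loop obey y(t+1) = (F + W(t)) y(t) + w(t) with
   F Schur and W, w exponentially decaying, and every such y decays exponentially:
   in a norm that F contracts, this is a scalar recursion.  With L the identity
   minus mu1 H, the entries of S_i - S form N-vectors driven by L, which is Schur
   because every eigenvalue of H has positive real part (Gershgorin for nonzero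
   eigenvalues, and a maximum principle along the spanning tree to exclude 0).
   Since v grows subexponentially, S_i - S decays faster than v can grow, so
   eta_i - v decays.  Uniqueness of the regulator equations makes Q_i invertible,
   so that Q_i^T Q_i has positive eigenvalues and the gradient iteration for zeta_i
   is again a perturbed Schur system, whence K_eta converges to U_i - Kx_i X_i and
   x_i - X_i v, hence e_i, decays. *)

(** * Exponential decay and subexponential growth *)

Section GrowthRates.
Variable R : realType.

Definition exp_bounded (V : normedModType R) (r : R) (f : nat -> V) :=
  exists c, forall t, `|f t| <= c * r ^+ t.

Definition decays (V : normedModType R) (f : nat -> V) :=
  exists2 r, 0 < r < 1 & exp_bounded r f.

(** Polynomial growth qualifies; an iteration whose spectrum meets the unit circle can grow this way
    because of its Jordan blocks. *)
Definition subexp (V : normedModType R) (f : nat -> V) :=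
  forall r, 1 < r -> exp_bounded r f.

Lemma exp_boundedP (V : normedModType R) r (f : nat -> V) :
  exp_bounded r f -> exists2 c, 0 <= c & forall t, `|f t| <= c * r ^+ t.
Proof.
move=> [c Hc]; exists c => //.
by have := le_trans (normr_ge0 _) (Hc 0%N); rewrite expr0 mulr1.
Qed.

Lemma exp_boundedW (V : normedModType R) r s (f : nat -> V) :
  0 <= r -> r <= s -> exp_bounded r f -> exp_bounded s f.
Proof.
move=> r0 rs /exp_boundedP[c c0 Hc]; exists c => t.
by apply: le_trans (Hc t) _; rewrite ler_wpM2l// lerXn2r// nnegrE// (le_trans r0).
Qed.

Lemma exp_boundedD (V : normedModType R) r (f g : nat -> V) :
  exp_bounded r f -> exp_bounded r g -> exp_bounded r (fun t => f t + g t).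
Proof.
move=> [c Hc] [d Hd]; exists (c + d) => t.
by rewrite mulrDl (le_trans (ler_normD _ _))// lerD.
Qed.

Lemma exp_bounded_le (V W : normedModType R) r (c : R) (f : nat -> V)
    (g : nat -> W) :
  0 <= c -> (forall t, `|f t| <= c * `|g t|) ->
  exp_bounded r g -> exp_bounded r f.
Proof.
move=> c0 fg [d Hd]; exists (c * d) => t.
by rewrite (le_trans (fg t))// -mulrA ler_wpM2l.
Qed.

(** Lets a rate be proved only past a transient: the finitely many earlier values are absorbed into
    the constant, one at a time. *)
Lemma exp_bounded_shift (V : normedModType R) r (f : nat -> V) T :
  0 < r -> exp_bounded r (fun t => f (T + t)%N) -> exp_bounded r f.
Proof.
move=> r0; elim: T => [//|T IH] /exp_boundedP[c c0 Hc].
apply: IH; exists (`|f T| + c / r) => -[|t].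
  by rewrite addn0 expr0 mulr1 lerDl divr_ge0// ltW.
have := Hc t; rewrite addSnnS => /le_trans; apply.
rewrite mulrDl exprS -[leLHS]add0r lerD//.
  by rewrite mulr_ge0// mulr_ge0 ?exprn_ge0// ltW.
by rewrite mulrA divfK// gt_eqF.
Qed.

Lemma decays_le (V W : normedModType R) (c : R) (f : nat -> V) (g : nat -> W) :
  0 <= c -> (forall t, `|f t| <= c * `|g t|) -> decays g -> decays f.
Proof.
by move=> c0 fg [r r01 Hg]; exists r => //; apply: exp_bounded_le fg Hg.
Qed.

Lemma subexp_le (V W : normedModType R) (c : R) (f : nat -> V) (g : nat -> W) :
  0 <= c -> (forall t, `|f t| <= c * `|g t|) -> subexp g -> subexp f.
Proof. by move=> c0 fg Hg r r1; apply: exp_bounded_le fg (Hg r r1). Qed.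

Lemma decays_cst0 (V : normedModType R) : decays (fun=> 0 : V).
Proof.
exists (2^-1); first by lra.
by exists 0 => t; rewrite normr0 mul0r.
Qed.

Lemma decaysD (V : normedModType R) (f g : nat -> V) :
  decays f -> decays g -> decays (fun t => f t + g t).
Proof.
move=> [r /andP[r0 r1] Hf] [s /andP[s0 s1] Hg]; exists (Num.max r s).
  by rewrite lt_max r0/= gt_max r1.
apply: exp_boundedD; first by apply: exp_boundedW Hf; rewrite ?le_max ?lexx// ltW.
by apply: exp_boundedW Hg; rewrite ?le_max ?lexx ?orbT// ltW.
Qed.

Lemma decaysZ (V : normedModType R) (a : R) (f : nat -> V) :
  decays f -> decays (fun t => a *: f t).
Proof. by apply: (@decays_le _ _ `|a|) => // t; rewrite normrZ. Qed.

Lemma decays_sum (V : normedModType R) (I : finType) (f : I -> nat -> V) :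
  (forall i, decays (f i)) -> decays (fun t => \sum_i f i t).
Proof.
move=> Hf; elim: (index_enum I) => [|i s IH].
  under [fun t => _]eq_fun do rewrite big_nil; exact: decays_cst0.
by under [fun t => _]eq_fun do rewrite big_cons; apply: decaysD.
Qed.

Lemma decays_bounded (V : normedModType R) (f : nat -> V) :
  decays f -> exists c, forall t, `|f t| <= c.
Proof.
move=> [r /andP[r0 r1] /exp_boundedP[c c0 Hc]]; exists c => t.
by rewrite (le_trans (Hc t))// ler_piMr// exprn_ile1// ltW.
Qed.

Lemma decays_cvg (V : normedModType R) (f : nat -> V) :
  decays f -> f @ \oo --> (0 : V).
Proof.
move=> [r /andP[r0 r1] [c Hc]]; apply/norm_cvg0P.
apply: (@squeeze_cvgr _ _ _ _ (fun=> 0) (fun t => c * r ^+ t)).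
- by near=> t; rewrite normr_ge0 Hc.
- exact: cvg_cst.
- by rewrite -[X in _ --> X](mulr0 c); apply: cvgMr; apply: cvg_expr; rewrite gtr0_norm.
Unshelve. all: by end_near.
Qed.

Lemma subexp_cst (V : normedModType R) (v : V) : subexp (fun=> v).
Proof. by move=> r r1; exists `|v| => t; rewrite ler_peMr// exprn_ege1// ltW. Qed.

Lemma subexpD (V : normedModType R) (f g : nat -> V) :
  subexp f -> subexp g -> subexp (fun t => f t + g t).
Proof. by move=> Hf Hg r r1; apply: exp_boundedD; [apply: Hf|apply: Hg]. Qed.

Lemma decays_subexp (V : normedModType R) (f : nat -> V) : decays f -> subexp f.
Proof.
move=> [r /andP[r0 r1] Hf] s s1; apply: exp_boundedW Hf; first exact: ltW.
exact/ltW/(lt_trans r1).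
Qed.

Lemma norm_entry_le m n (A : 'M[R]_(m, n)) i j : `|A i j| <= `|A|.
Proof.
rewrite [leRHS]mx_normrE; exact: (le_bigmax _ (fun ij => `|A ij.1 ij.2|) (i, j)).
Qed.

Lemma mx_norm_le m n (A : 'M[R]_(m, n)) c :
  0 <= c -> (forall i j, `|A i j| <= c) -> `|A| <= c.
Proof. by move=> c0 Ac; rewrite [leLHS]mx_normrE; apply/bigmax_leP; split. Qed.

Lemma norm_mulmx_le m n p (A : 'M[R]_(m, n)) (B : 'M[R]_(n, p)) :
  `|A *m B| <= n%:R * `|A| * `|B|.
Proof.
apply: mx_norm_le => [|i j]; first by rewrite !mulr_ge0.
rewrite mxE (le_trans (ler_norm_sum _ _ _))//.
apply: (@le_trans _ _ (\sum_(k < n) `|A| * `|B|)).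
  by apply: ler_sum => k _; rewrite normrM ler_pM// norm_entry_le.
by rewrite sumr_const card_ord -mulrA mulr_natl.
Qed.

Lemma exp_bounded_entries m n r (f : nat -> 'M[R]_(m, n)) : 0 <= r ->
  (forall i j, exp_bounded r (fun t => f t i j : R^o)) -> exp_bounded r f.
Proof.
move=> r0 Hf.
have /choice[c Hc] : forall ij : 'I_m * 'I_n, exists c,
    0 <= c /\ forall t, `|f t ij.1 ij.2| <= c * r ^+ t.
  by move=> ij; have [c c0 Hc] := exp_boundedP (Hf ij.1 ij.2); exists c.
exists (\sum_ij c ij) => t; apply: mx_norm_le => [|i j].
  by rewrite mulr_ge0 ?exprn_ge0// sumr_ge0// => ij _; have [] := Hc ij.
have [_ /(_ t)/le_trans] := Hc (i, j); apply.
rewrite ler_wpM2r ?exprn_ge0// (bigD1 (i, j))//= lerDl sumr_ge0// => ij _.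
by have [] := Hc ij.
Qed.

Lemma decays_entry m n (f : nat -> 'M[R]_(m, n)) i j :
  decays f -> decays (fun t => f t i j : R^o).
Proof. by apply: (@decays_le _ _ 1) => // t; rewrite mul1r norm_entry_le. Qed.

Lemma decays_entries m n (f : nat -> 'M[R]_(m, n)) :
  (forall i j, decays (fun t => f t i j : R^o)) -> decays f.
Proof.
move=> Hf.
rewrite (_ : f = fun t => \sum_i \sum_j f t i j *: delta_mx i j); last first.
  by apply/funext => t; rewrite -matrix_sum_delta.
apply: decays_sum => i; apply: decays_sum => j; move: (Hf i j).
by apply: (@decays_le _ _ `|delta_mx i j : 'M[R]_(m, n)|) => // t; rewrite normrZ mulrC.
Qed.

Lemma decays_mulmx m n p (f : nat -> 'M[R]_(m, n)) (g : nat -> 'M[R]_(n, p)) :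
  decays f -> subexp g -> decays (fun t => f t *m g t).
Proof.
move=> [r /andP[r0 r1] /exp_boundedP[c c0 Hc]] Hg.
have ri1 : 1 < r^-1 by rewrite invf_gt1.
(* The midpoint of [1] and [r^-1] is a growth rate above 1 whose product with [r] is still below
   1. *)
have s1 : 1 < (1 + r^-1) / 2 by lra.
have [d Hd] := Hg _ s1.
have rs : r * ((1 + r^-1) / 2) = (r + 1) / 2 by field; rewrite gt_eqF.
exists ((r + 1) / 2); first by lra.
exists (n%:R * c * d) => t; rewrite -rs exprMn.
apply: le_trans (norm_mulmx_le _ _) _.
rewrite -!mulrA ler_wpM2l// [leRHS](_ : _ = c * r ^+ t * (d * ((1 + r^-1) / 2) ^+ t)).
  by rewrite ler_pM.
by rewrite -!mulrA; congr (_ * _); rewrite mulrCA.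
Qed.

Lemma decays_mulmxr m n p (f : nat -> 'M[R]_(m, n)) (g : nat -> 'M[R]_(n, p)) :
  subexp f -> decays g -> decays (fun t => f t *m g t).
Proof.
(* Transposition swaps the factors, and both rates survive it because the norm is the largest
   modulus of an entry. *)
move=> Hf Hg; under eq_fun do rewrite -[_ *m _]trmxK trmx_mul.
apply: decays_entries => i j; under eq_fun do rewrite mxE.
apply: decays_entry; apply: decays_mulmx.
  by apply: decays_entries => k l; under eq_fun do rewrite mxE; apply: decays_entry.
apply: (@subexp_le _ _ 1 _ _ ler01 _ Hf) => t; rewrite mul1r.
by apply: mx_norm_le => // k l; rewrite mxE norm_entry_le.
Qed.

Lemma decays_trmx m n (f : nat -> 'M[R]_(m, n)) :
  decays f -> decays (fun t => (f t)^T).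
Proof.
move=> Hf; apply: decays_entries => i j; under eq_fun do rewrite mxE.
exact: decays_entry.
Qed.

End GrowthRates.

(** * Powers of a matrix *)

Section PowerBound.
Variable R : realType.
Local Notation rc := (real_complex R).

Lemma normc_real (x : R) : Normc.normc x%:C%C = `|x|.
Proof. by rewrite /Normc.normc /= expr0n addr0 sqrtr_sqr. Qed.

Lemma normcD_le (x y : R[i]) :
  Normc.normc (x + y) <= Normc.normc x + Normc.normc y.
Proof. exact: (@le_normcD _ x y). Qed.

Lemma normc_nonneg (x : R[i]) : 0 <= Normc.normc x.
Proof. by case: x => a b; exact: sqrtr_ge0. Qed.

Lemma spectrum_seq n (A : 'M[R]_n) : exists2 s : seq R[i],
    char_poly (map_mx rc A) = \prod_(z <- s) ('X - z%:P) &
    forall l, spectrum A l <-> l \in s.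
Proof.
have [s Hs] := closed_field_poly_normal (char_poly (map_mx rc A)).
rewrite (monicP (char_poly_monic _)) scale1r in Hs; exists s => // l.
by rewrite /spectrum /= eigenvalue_root_char Hs root_prod_XsubC.
Qed.

Lemma linear_recurrence_bound (u : nat -> R[i]) (z : R[i]) (r c : R) :
  Normc.normc z < r -> 0 <= c ->
  (forall t, Normc.normc (u t.+1 - z * u t) <= c * r ^+ t) ->
  exists2 d, 0 <= d & forall t, Normc.normc (u t) <= d * r ^+ t.
Proof.
move=> zr c0 Hu; have r0 : 0 < r by apply: le_lt_trans zr; exact: normc_nonneg.
(* [d] covers [u 0] and satisfies [c <= d * (r - Normc.normc z)], which closes the induction. *)
set d := Normc.normc (u 0%N) + c / (r - Normc.normc z).
have cd : c / (r - Normc.normc z) <= d by rewrite lerDr normc_nonneg.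
have d0 : 0 <= d by rewrite (le_trans _ cd)// divr_ge0// subr_ge0 ltW.
exists d => //; elim=> [|t IH].
  by rewrite expr0 mulr1 lerDl divr_ge0// subr_ge0 ltW.
rewrite -[u t.+1](subrK (z * u t)) (le_trans (normcD_le _ _))// Normc.normcM.
apply: le_trans (lerD (Hu t) (ler_wpM2l (normc_nonneg z) IH)) _.
rewrite mulrA -mulrDl exprS mulrA ler_wpM2r ?(exprn_ge0 _ (ltW r0))//.
by move: cd; rewrite ler_pdivrMr ?subr_gt0// mulrBr lerBrDr [d * _]mulrC.
Qed.

(* By Cayley-Hamilton the product of the factors [F - z] over the eigenvalues z
   vanishes; the factors are removed one at a time. *)
Lemma exp_bounded_pow n (F : 'M[R]_n) (r : R) : 0 < r ->
  (forall l, spectrum F l -> Normc.normc l < r) ->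
  exp_bounded r (fun t => F ^+ t : 'M[R]_n).
Proof.
case: n F => [|n] F r0 Hr.
  by apply: exp_bounded_entries => [|[]//]; exact: ltW.
apply: exp_bounded_entries => [|i j]; first exact: ltW.
have [s Hs Hsr] := spectrum_seq F; set Fc := map_mx rc F in Hs.
(* Entry [(i, j)] of [p(F) F^t]: it vanishes when [p] is the characteristic polynomial and is the
   entry of the power itself when [p = 1]. *)
pose u p t := (horner_mx Fc p *m Fc ^+ t) i j.
have {Hr} : {in s, forall z, Normc.normc z < r} by move=> z /Hsr/Hr.
have : exists2 c, 0 <= c & forall t,
    Normc.normc (u (\prod_(z <- s) ('X - z%:P)) t) <= c * r ^+ t.
  exists 0 => // t; rewrite /u -Hs Cayley_Hamilton mul0mx mxE Normc.normc0.
  by rewrite mul0r.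
elim: s {Hs Hsr} => [|z s IH] [c c0 Hc] sr.
  exists c => t; have := Hc t; rewrite /u big_nil rmorph1 mul1mx.
  by rewrite -(rmorphXn (map_mx rc)) mxE normc_real.
apply: IH => [|w ws]; last by apply: sr; rewrite inE ws orbT.
(* Multiplying [p] by ['X - z] replaces [u p t] by [u p t.+1 - z * u p t], so removing that factor
   amounts to solving a first-order recurrence. *)
apply: (@linear_recurrence_bound _ z r c) => // [|t].
  by apply: sr; rewrite mem_head.
have := Hc t; rewrite /u big_cons mulrC rmorphM/= rmorphB/= horner_mx_X horner_mx_C.
set P := horner_mx Fc _.
rewrite -[_ *m _ ^+ t]mulmxA mulmxBl mul_scalar_mx mulmxBr -scalemxAr exprS.
by rewrite !mxE.
Qed.

End PowerBound.

(** * Perturbed Schur systems *)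

Section Perturbation.
Variable R : realType.

Lemma exprn_eventually_le (s D e : R) : 0 < s < 1 -> 0 < e ->
  exists T, D * s ^+ T <= e.
Proof.
move=> /andP[s0 s1] e0.
have /cvgr0_norm_le/(_ e e0)[T _ HT] : (fun t => D * s ^+ t) @ \oo --> (0 : R^o).
  apply: (@decays_cvg R R^o); exists s; first by rewrite s0.
  by exists `|D| => t; rewrite normrM (ger0_norm (exprn_ge0 _ (ltW s0))).
by exists T; rewrite (le_trans (ler_norm _))// HT/=.
Qed.

(** The spectrum is finite, so the strict bounds leave a uniform gap below 1. *)
Lemma Schur_radius n (F : 'M[R]_n) : is_Schur F ->
  exists2 r, 0 < r < 1 & forall l, spectrum F l -> Normc.normc l < r.
Proof.
move=> FS; have [s _ Hs] := spectrum_seq F.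
have {FS} : forall l, l \in s -> Normc.normc l < 1 by move=> l /Hs/FS.
have : forall l, spectrum F l -> l \in s by move=> l /Hs.
(* Induction on the list requires an arbitrary set contained in it in place of the spectrum. *)
elim: s {Hs} (spectrum F) => [|z s IH] P HP Hs.
  by exists (2^-1) => [|l /HP//]; lra.
have [||r /andP[r0 r1] Hr] := IH (fun l => l \in s) => //.
  by move=> l ls; rewrite Hs// inE ls orbT.
have z1 := Hs z (mem_head _ _); have z0 := normc_nonneg z.
exists (Num.max r ((1 + Normc.normc z) / 2)).
  by rewrite lt_max r0 gt_max r1/=; lra.
move=> l /HP; rewrite inE => /predU1P[->|/Hr lr]; last by rewrite lt_max lr.
by rewrite lt_max; apply/orP; right; lra.
Qed.

(** Every [r] above 1 strictly exceeds all eigenvalue moduli, so the bound on powers applies at each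
    such rate. *)
Lemma subexp_iter n p (S : 'M[R]_n) (v : nat -> 'M[R]_(n, p)) :
  (forall l, spectrum S l -> Normc.normc l <= 1) ->
  (forall t, v t.+1 = S *m v t) -> subexp v.
Proof.
move=> HS Hv r r1.
have r0 : 0 < r by apply: lt_trans r1.
have [l /HS l1|c Hc] := @exp_bounded_pow _ _ S r r0; first exact: le_lt_trans r1.
exists (n%:R * c * `|v 0%N|) => t.
have -> : v t = (S ^+ t : 'M[R]_n) *m v 0%N.
  by elim: t => [|t IH]; rewrite ?expr0 ?mul1mx// Hv IH mulmxA exprS.
apply: le_trans (norm_mulmx_le _ _) _; rewrite -!mulrA ler_wpM2l//.
by rewrite [X in _ <= c * X]mulrC mulrA ler_wpM2r.
Qed.

(** The norm is the truncated weighted orbit sum of [|F^j y| / r^j] for [j <= k]. Applying [F]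
    shifts the sum and gains a factor [r]; the truncation is chosen so long that the new last term
    is at most the dropped first one. *)
Lemma adapted_norm n p (F : 'M[R]_n) : is_Schur F ->
  exists r c (h : 'M[R]_(n, p) -> R), [/\ 0 < r < 1, 0 <= c,
    (forall y, `|y| <= h y <= c * `|y|), (forall y z, h (y + z) <= h y + h z) &
    (forall y, h (F *m y) <= r * h y)].
Proof.
move=> /Schur_radius[s /andP[s0 s1] Hs].
have /exp_boundedP[c c0 Hc] := exp_bounded_pow s0 Hs.
set r := (1 + s) / 2.
have sr : s < r by rewrite /r; lra.
have r1 : r < 1 by rewrite /r; lra.
have r0 : 0 < r by apply: lt_trans sr.
have sr1 : 0 < s / r < 1 by rewrite divr_gt0//= ltr_pdivrMr ?mul1r.
(* Powers of [F] are of order [s ^+ k] with [s < r], so after division by [r ^+ k.+1] the constant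
   [n%:R * c] is eventually beaten. *)
have [k Hk] : exists k, n%:R * c * (s / r) ^+ k.+1 <= 1.
  have [k Hk] := exprn_eventually_le (n%:R * c) sr1 ltr01; exists k.
  have /andP[q0 q1] := sr1; apply: le_trans Hk; rewrite ler_wpM2l ?mulr_ge0//.
  by rewrite exprS ler_piMl ?exprn_ge0// ltW.
have powle j (y : 'M[R]_(n, p)) :
    `|(F ^+ j : 'M[R]_n) *m y| <= n%:R * c * s ^+ j * `|y|.
  apply: le_trans (norm_mulmx_le _ _) _.
  by rewrite ler_wpM2r// -mulrA ler_wpM2l.
pose g j (y : 'M[R]_(n, p)) := `|(F ^+ j : 'M[R]_n) *m y| * r ^- j.
have g0 j y : 0 <= g j y by rewrite mulr_ge0// invr_ge0 exprn_ge0 // ltW.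
have g_id y : g 0%N y = `|y| by rewrite /g expr0 mul1mx invr1 mulr1.
have gF j y : g j (F *m y) = r * g j.+1 y.
  rewrite /g mulmxA (_ : _ *m F = F ^+ j.+1); last by rewrite exprSr.
  by rewrite [r ^+ j.+1]exprS invfM [RHS]mulrCA mulVKf ?gt_eqF.
have g_k y : g k.+1 y <= `|y|.
  rewrite /g ler_pdivrMr ?exprn_gt0// (le_trans (powle _ _))// mulrC ler_wpM2l//.
  by move: Hk; rewrite expr_div_n mulrA ler_pdivrMr ?exprn_gt0// mul1r.
exists r, (\sum_(j < k.+1) n%:R * c * s ^+ j * r ^- j),
  (fun y => \sum_(j < k.+1) g j y).
split => [||y|y z|y].
- by rewrite r0.
- by apply: sumr_ge0 => j _; rewrite !mulr_ge0 ?invr_ge0 ?exprn_ge0// ltW.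
- apply/andP; split.
    by rewrite big_ord_recl/= g_id lerDl sumr_ge0.
  rewrite mulr_suml ler_sum// => j _; rewrite [leRHS]mulrAC ler_wpM2r//.
  by rewrite invr_ge0 exprn_ge0// ltW.
- rewrite -big_split/= ler_sum// => j _.
  by rewrite /g -mulrDl mulmxDr ler_wpM2r ?ler_normD// invr_ge0 exprn_ge0// ltW.
(* The shifted sum and the original one share all terms except [g k.+1 y] and [g 0 y = |y|]. *)
- under eq_bigr do rewrite gF.
  rewrite -mulr_sumr ler_wpM2l ?(ltW r0)// big_ord_recr big_ord_recl/= addrC.
  by rewrite g_id lerD.
Qed.

(* Past the time when [D * s ^+ t <= q - r], the sequence [z t + K * s ^+ t] is
   contracted by q, where K = D / (q - s) absorbs the inhomogeneous term. *)
Lemma exp_bounded_scalar (z : nat -> R) (r s D : R) :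
  0 < r < 1 -> 0 < s < 1 -> 0 <= D -> (forall t, 0 <= z t) ->
  (forall t, z t.+1 <= (r + D * s ^+ t) * z t + D * s ^+ t) ->
  decays (z : nat -> R^o).
Proof.
move=> /andP[r0 r1] /andP[s0 s1] D0 z0 Hz.
set q := (1 + Num.max r s) / 2.
have [rm sm m1] : [/\ r <= Num.max r s, s <= Num.max r s & Num.max r s < 1].
  by rewrite !le_max !lexx orbT gt_max r1 s1.
have [rq sq q1] : [/\ r < q, s < q & q < 1] by rewrite /q; split; lra.
have q0 : 0 < q by apply: lt_trans rq.
exists q; first by rewrite q0.
have [T HT] : exists T, D * s ^+ T <= q - r.
  by apply: exprn_eventually_le; rewrite ?s0 ?subr_gt0.
apply: (@exp_bounded_shift _ _ _ _ T q0).
set K := D / (q - s).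
have K0 : 0 <= K by rewrite divr_ge0// subr_ge0 ltW.
have KD : K * q = D + K * s.
  by rewrite /K; field; rewrite subr_eq0 gt_eqF.
exists (z T + K * s ^+ T) => t; rewrite ger0_norm//.
apply: (@le_trans _ _ (z (T + t)%N + K * s ^+ (T + t))).
  by rewrite lerDl mulr_ge0// exprn_ge0// ltW.
elim: t => [|t IH]; first by rewrite addn0 expr0 mulr1.
rewrite addnS [q ^+ _]exprSr [leRHS]mulrA; apply: (le_trans _ (ler_wpM2r (ltW q0) IH)).
have st0 : 0 <= s ^+ (T + t) by rewrite exprn_ge0// ltW.
have DT : D * s ^+ (T + t) <= q - r.
  apply: le_trans HT; rewrite ler_wpM2l// exprD ler_piMr//.
    by rewrite exprn_ge0// ltW.
  by rewrite exprn_ile1// ltW.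
have := Hz (T + t)%N; have := z0 (T + t)%N; rewrite exprS.
move: (s ^+ (T + t)) (z (T + t)%N) st0 DT => x a x0 DT a0 Hb.
have : (r + D * x) * a <= q * a by rewrite ler_wpM2r// -lerBrDl.
have -> : (a + K * x) * q = q * a + D * x + K * s * x by rewrite mulrDl mulrAC KD; ring.
move: Hb; lra.
Qed.

Lemma Schur_perturbed n p (F : 'M[R]_n) (W : nat -> 'M[R]_n)
    (w y : nat -> 'M[R]_(n, p)) :
  is_Schur F -> decays W -> decays w ->
  (forall t, y t.+1 = (F + W t) *m y t + w t) -> decays y.
Proof.
move=> /(@adapted_norm _ p)[r [c [h [r01 c0 hle hD hF]]]] HW Hw Hy.
(* The multiplicative and additive perturbations, converted to the adapted norm, are put under one
   decaying bound, since the scalar recursion has a single rate. *)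
have : decays (fun t => (n%:R * c * `|W t| + c * `|w t| : R^o)).
  apply: decaysD.
    apply: (@decays_le _ _ _ (n%:R * c) _ W) => // [|t]; first by rewrite mulr_ge0.
    by rewrite ger0_norm// !mulr_ge0.
  apply: (@decays_le _ _ _ c _ w) => // t.
  by rewrite ger0_norm// !mulr_ge0.
move=> [s s01 /exp_boundedP[d d0 Hd]].
have h0 x : 0 <= h x by have /andP[/(le_trans (normr_ge0 _))] := hle x.
apply: (@decays_le _ _ _ 1 _ (fun t => h (y t) : R^o)) => // [t|].
  by rewrite mul1r ger0_norm//; have /andP[] := hle (y t).
apply: (@exp_bounded_scalar _ r s d) => // t.
have dt : n%:R * c * `|W t| + c * `|w t| <= d * s ^+ t.
  by apply: le_trans (Hd t); exact: ler_norm.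
rewrite Hy mulmxDl; apply: le_trans (hD _ _) _.
have ws : h (w t) <= c * `|w t| by have /andP[] := hle (w t).
have Wy : h (W t *m y t) <= n%:R * c * `|W t| * h (y t).
  have /andP[_ /le_trans] := hle (W t *m y t); apply.
  apply: (@le_trans _ _ (c * (n%:R * `|W t| * `|y t|))).
    by rewrite ler_wpM2l// norm_mulmx_le.
  rewrite mulrA [c * _]mulrCA !mulrA ler_wpM2l ?mulr_ge0//.
  by have /andP[] := hle (y t).
have cw : n%:R * c * `|W t| <= d * s ^+ t.
  by apply: le_trans dt; rewrite lerDl mulr_ge0.
have cw' : c * `|w t| <= d * s ^+ t.
  by apply: le_trans dt; rewrite lerDr !mulr_ge0.
apply: lerD; last exact: le_trans cw'.
rewrite mulrDl; apply: le_trans (hD _ _) (lerD (hF _) _).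
by apply: le_trans Wy _; rewrite ler_wpM2r.
Qed.

End Perturbation.

(** * Spectra *)

Section Spectra.
Variable R : realType.
Local Notation rc := (real_complex R).
Implicit Types l : R[i].

Lemma normc_sqr l : Normc.normc l ^+ 2 = complex.Re l ^+ 2 + complex.Im l ^+ 2.
Proof. by case: l => x y /=; rewrite sqr_sqrtr// addr_ge0// sqr_ge0. Qed.

Lemma seq_has_max (s : seq R) x : x \in s ->
  exists2 m, m \in s & forall y, y \in s -> y <= m.
Proof.
elim: s x => [//|a s IH] x _; case: s IH => [|b s] IH.
  by exists a; rewrite ?mem_head// => y; rewrite inE => /eqP->.
have [m ms Hm] := IH b (mem_head _ _).
have [am|/ltW ma] := leP a m.
  exists m; first by rewrite inE ms orbT.
  by move=> y; rewrite inE => /predU1P[->//|/Hm].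
exists a; first exact: mem_head.
by move=> y; rewrite inE => /predU1P[->//|/Hm/le_trans]; apply.
Qed.

Lemma rho_ge n (M : 'M[R]_n) l :
  spectrum M l -> Normc.normc l ^+ 2 / complex.Re l <= rho M.
Proof.
move=> Ml; have [s _ Hs] := spectrum_seq M.
pose f l := Normc.normc l ^+ 2 / complex.Re l.
have [m ms Hm] := seq_has_max (map_f f ((Hs l).1 Ml)).
(* The spectrum is finite and contains [l], so the maximum is attained and [xget] returns it rather
   than the default 0. *)
have [|_] := @xgetPex _ (0 : R) [set m | [set f l | l in spectrum M] m /\
   ubound [set f l | l in spectrum M] m].
  exists m; split.
    by have /mapP[z /Hs zs ->] := ms; exists z.
  by move=> _ [z /Hs zs <-]; apply/Hm/map_f.
by apply; exists l.
Qed.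

(** Eigenvalues of [1 - mu M] are [1 - mu k] with [k] an eigenvalue of [M], and [|1 - mu k|^2 = 1 -
    2 mu Re k + mu^2 |k|^2] is below 1 exactly when [mu |k|^2 < 2 Re k]. *)
Lemma Schur_one_subZ n (M : 'M[R]_n) mu :
  (forall l, spectrum M l -> 0 < complex.Re l) ->
  0 < mu < 2 / rho M -> is_Schur (1%:M - mu *: M).
Proof.
move=> Mpos /andP[mu0 muM] l /eigenvalueP[v].
rewrite map_mxB map_mx1 map_mxZ mulmxBr mulmx1 -scalemxAr => Hv v0.
have muC0 : mu%:C%C != 0 by rewrite fmorph_eq0 gt_eqF.
pose k := (1 - l) / mu%:C%C.
have Mk : spectrum M k.
  apply/eigenvalueP; exists v => //.
  have : mu%:C%C *: (v *m map_mx rc M) = (1 - l) *: v.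
    by rewrite scalerBl scale1r -Hv opprB addrC subrK.
  by move/(congr1 (fun w => mu%:C%C^-1 *: w)); rewrite !scalerA mulVf// scale1r mulrC.
have -> : l = 1 - mu%:C%C * k by rewrite /k mulrC divfK// opprB addrC subrK.
have Rk := Mpos _ Mk; have := rho_ge Mk.
rewrite ler_pdivrMr// => krho.
(* Positivity of [2 / rho M] already forces [rho M > 0], because the inverse of 0 is 0. *)
have rho0 : 0 < rho M by have := lt_trans mu0 muM; rewrite pmulr_rgt0// invr_gt0.
rewrite -(@expr_lt1 _ 2)//; last exact: normc_nonneg.
move: muM; rewrite ltr_pdivlMr// => muM.
move: krho; rewrite !normc_sqr; case: k {Mk} Rk => x y /= x0 krho.
rewrite !mul0r subr0 addr0 sub0r sqrrN.
have : mu * (x ^+ 2 + y ^+ 2) < 2 * x.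
  apply: le_lt_trans (ler_wpM2l (ltW mu0) krho) _.
  by rewrite mulrA ltr_pM2r.
rewrite -(ltr_pM2l mu0); nra.
Qed.

(** [eigenvalue] speaks of row eigenvectors, while dominance along rows calls for column ones;
    [g - a] and its transpose have the same rank. *)
Lemma eigenvalue_trmx (K : fieldType) n (g : 'M[K]_n) a :
  eigenvalue g^T a = eigenvalue g a.
Proof.
rewrite /eigenvalue /eigenspace -!mxrank_eq0 !mxrank_ker -(mxrank_tr (g - _)).
by rewrite linearB/= tr_scalar_mx.
Qed.

Lemma mulc_conj l : l * conjc l = (Normc.normc l ^+ 2)%:C%C.
Proof.
case: l => x y; rewrite normc_sqr /=; apply/eqP; rewrite eq_complex /=.
by apply/andP; split; apply/eqP; ring.
Qed.

Definition sqnorm n (v : 'rV[R[i]]_n) : R := \sum_k Normc.normc (v 0 k) ^+ 2.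

Lemma sqnormE n (v : 'rV[R[i]]_n) :
  v *m (map_mx conjc v)^T = (sqnorm v)%:C%C%:M.
Proof.
apply/matrixP => i j; rewrite !ord1 !mxE eqxx mulr1n rmorph_sum /=.
by apply: eq_bigr => k _; rewrite !mxE mulc_conj.
Qed.

Lemma sqnorm_gt0 n (v : 'rV[R[i]]_n) : v != 0 -> 0 < sqnorm v.
Proof.
move=> v0; rewrite lt_neqAle sumr_ge0 ?andbT; last by move=> k _; rewrite sqr_ge0.
apply: contra v0; rewrite eq_sym psumr_eq0; last by move=> k _; rewrite sqr_ge0.
move=> /allP Hv; apply/eqP/rowP => k; rewrite mxE.
have := Hv k (mem_index_enum _); rewrite sqrf_eq0 => /eqP; exact: Normc.eq0_normc.
Qed.

(** For a row eigenvector [v], the squared norm of [v Q^T] equals [l] times that of [v], and both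
    norms are positive. *)
Lemma spectrum_gram_pos n (Q : 'M[R]_n) : Q \in unitmx ->
  forall l, spectrum (Q^T *m Q) l -> 0 < complex.Re l.
Proof.
move=> Qu l /eigenvalueP[v Hv v0]; set u := v *m map_mx rc Q^T.
have u0 : u != 0.
  have Tu : map_mx rc Q^T \in unitmx by rewrite map_unitmx unitmx_tr.
  apply: contra v0 => /eqP u0; rewrite -(mulmxK Tu v).
  by rewrite [v *m _]u0 mul0mx.
have : u *m (map_mx conjc u)^T = l *: (v *m (map_mx conjc v)^T).
  rewrite scalemxAl -Hv [map_mx rc _]map_mxM mulmxA -/u -[in RHS]mulmxA; congr (_ *m _).
  rewrite /u map_mxM trmx_mul; congr (_ *m _).
  by apply/matrixP => i j; rewrite !mxE; exact: conjc_real.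
rewrite !sqnormE => /matrixP/(_ 0 0); rewrite !mxE eqxx !mulr1n.
move=> /(congr1 (@complex.Re R)); case: (l) => x y /=; rewrite mulr0 subr0 => E.
by rewrite -(pmulr_lgt0 _ (sqnorm_gt0 v0)) -E sqnorm_gt0.
Qed.

Lemma normc_sum_le (I : Type) (s : seq I) (P : pred I) (f : I -> R[i]) :
  Normc.normc (\sum_(i <- s | P i) f i) <= \sum_(i <- s | P i) Normc.normc (f i).
Proof.
elim/big_rec2: _ => [|i x y _ xy]; first by rewrite Normc.normc0.
by rewrite (le_trans (normcD_le _ _))// lerD2l.
Qed.

(* Gershgorin: l lies in a disk of center [M i i] and radius at most [M i i]. *)
Lemma spectrum_diag_dominant n (M : 'M[R]_n) :
  (forall i, \sum_(j | j != i) `|M i j| <= M i i) ->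
  forall l, spectrum M l -> l != 0 -> 0 < complex.Re l.
Proof.
move=> Mdom l; rewrite /spectrum /= -eigenvalue_trmx => /eigenvalueP[v Hv v0] l0.
case: n => [|n] in M Mdom v Hv v0 *; first by rewrite (thinmx0 v) eqxx in v0.
(* The disk is the one of the row where the eigenvector has its entry of largest modulus. *)
pose i := [arg max_(i > ord0) Normc.normc (v 0 i)]%O.
have vi j : Normc.normc (v 0 j) <= Normc.normc (v 0 i).
  by rewrite /i; case: arg_maxP => // k _; apply.
have vi0 : 0 < Normc.normc (v 0 i).
  rewrite lt_neqAle normc_nonneg andbT; apply: contra v0 => /eqP vi0.
  apply/eqP/rowP => j; rewrite mxE; apply: Normc.eq0_normc.
  by apply/eqP; rewrite eq_le normc_nonneg vi0 vi.
have : (l - (M i i)%:C%C) * v 0 i = \sum_(j | j != i) (M i j)%:C%C * v 0 j.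
  move/rowP/(_ i): Hv; rewrite !mxE (bigD1 i)//= !mxE mulrBl => <-.
  rewrite mulrC addrAC subrr add0r.
  by apply: eq_bigr => j _; rewrite !mxE mulrC.
move/(congr1 (@Normc.normc R)); rewrite Normc.normcM => E.
have : Normc.normc (l - (M i i)%:C%C) * Normc.normc (v 0 i) <=
       M i i * Normc.normc (v 0 i).
  rewrite E (le_trans (normc_sum_le _ _ _))//.
  apply: le_trans (ler_wpM2r (ltW vi0) (Mdom i)).
  rewrite mulr_suml ler_sum// => j _.
  by rewrite Normc.normcM normc_real ler_wpM2l.
rewrite ler_pM2r// => H.
have M0 : 0 <= M i i by apply: le_trans H; exact: normc_nonneg.
have : Normc.normc (l - (M i i)%:C%C) ^+ 2 <= M i i ^+ 2.
  by rewrite lerXn2r// nnegrE normc_nonneg.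
rewrite normc_sqr; move: l0; case: (l) => x y; rewrite eq_complex /= negb_and.
rewrite subr0 => /orP xy; rewrite lt_neqAle => H2.
(* The squared disk condition reads [x^2 + y^2 <= 2 (M i i) x]; a positive left side forces
   [x > 0]. *)
have : 0 < x ^+ 2 + y ^+ 2.
  case: xy => ?; [rewrite ltr_pwDl|rewrite ltr_pwDr] => //;
    by rewrite ?sqr_ge0 ?exprn_even_gt0.
nra.
Qed.

End Spectra.

(** * The communication graph *)

Section Network.
Variable R : realType.

(** Each difference [f j - f i] is a difference of errors relative to the leader, and the leader's
    own error is 0; the coupling thus becomes linear in the followers' errors alone. *)
Lemma consensus_errorE N (V : lmodType R) (a : 'M[R]_N.+1) (l : V)
    (f : 'I_N -> V) (i : 'I_N) : a (lift ord0 i) (lift ord0 i) = 0 ->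
  \sum_(j < N.+1) a (lift ord0 i) j *: (with_leader l f j - f i) =
  - \sum_(j < N) Hmx a i j *: (f j - l).
Proof.
move=> aii; rewrite big_ord_recl /with_leader unlift_none.
under eq_bigr do rewrite liftK.
rewrite [in RHS](bigD1 i)//= mxE eqxx opprD -scalerN opprB big_ord_recl.
rewrite scalerDl -addrA; congr (_ + _).
rewrite scaler_suml -sumrN [in LHS](bigD1 i)//= [in RHS](bigD1 i)//= aii !scale0r.
rewrite !add0r -big_split/=; apply: eq_bigr => j ji.
rewrite mxE eq_sym (negPf ji) scaleNr opprK -scalerDr; congr (_ *: _).
by rewrite [RHS]addrC subrKA.
Qed.

(** At a non-root node attaining the maximum, the sum of nonpositive terms [a i j (x j - x i)]
    vanishes, so every in-neighbor attains it too; going back along the tree reaches the root. *)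
Lemma max_principle N (edge : rel 'I_N.+1) (a : 'M[R]_N.+1) (x : 'I_N.+1 -> R) :
  weighted_adjacency edge a -> has_spanning_tree_from edge ord0 ->
  (forall i, i != ord0 -> \sum_j a i j * (x j - x i) = 0) ->
  forall i, x i <= x ord0.
Proof.
move=> [_ apos a0] tree Hx i.
pose k := [arg max_(i > ord0) x i]%O.
have xk j : x j <= x k by rewrite /k; case: arg_maxP => // ? _; apply.
suff -> : x ord0 = x k by [].
(* The path is read forwards while the argument runs backwards, so the induction carries an
   implication from the current node [y] to the root. *)
suff H p y : path edge y p -> k = last y p -> (x y = x k -> x ord0 = x k) ->
    x ord0 = x k.
  by have /connectP[p pp kp] := tree k; exact: H pp kp id.
elim: p y => [|z p IH] y /=; first by move=> _ ky; apply; rewrite -ky.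
move=> /andP[yz zp] kz Hy; have [z0|z0] := eqVneq z ord0.
  by apply: (IH z) => //; rewrite z0.
apply: (IH z) => // xz; apply: Hy.
have : \sum_j a z j * (x k - x j) == 0.
  rewrite -oppr_eq0 -sumrN; apply/eqP; rewrite -[RHS](Hx z z0); apply: eq_bigr => j _.
  by rewrite -mulrN opprB xz.
rewrite psumr_eq0 => [/allP/(_ y (mem_index_enum _))|j _].
  by rewrite mulf_eq0 gt_eqF ?apos//= subr_eq0 => /eqP.
apply: mulr_ge0; last by rewrite subr_ge0.
by have [/apos/ltW//|/a0->] := boolP (edge j z).
Qed.

(** A kernel vector of [H], extended by 0 at the leader, satisfies the maximum principle together
    with its negative, hence is 0. *)
Lemma det_Hmx_neq0 N (edge : rel 'I_N.+1) (a : 'M[R]_N.+1) :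
  weighted_adjacency edge a -> has_spanning_tree_from edge ord0 ->
  \det (Hmx a) != 0.
Proof.
move=> adj tree; have [aii _ _] := adj.
rewrite -det_tr; apply/det0P => -[v v0 Hv].
(* The factor [s] serves both signs, [1] and [-1]. *)
have Hx (s : R) (i : 'I_N.+1) : i != ord0 ->
    \sum_j a i j * (with_leader 0 (fun k => s * v 0 k) j -
                    with_leader 0 (fun k => s * v 0 k) i) = 0.
  rewrite eq_sym => /unlift_some[k -> _].
  have -> : with_leader 0 (fun k => s * v 0 k) (lift ord0 k) = s * v 0 k.
    by rewrite /with_leader liftK.
  apply: etrans (consensus_errorE (V := R^o) 0 (fun k => s * v 0 k) (aii _)) _.
  apply/eqP; rewrite oppr_eq0; apply/eqP.
  move/rowP/(_ k)/(congr1 ( *%R s)): Hv.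
  rewrite [LHS]/= mxE [in RHS]mxE mulr0 mulr_sumr => Hv.
  rewrite -[RHS]Hv; apply: eq_bigr => j _.
  by rewrite subr0 -[_ *: _]/(_ * _) [in RHS]mxE mulrCA [v 0 j * _]mulrC.
case/negP: v0; apply/eqP/rowP => k; rewrite mxE; apply/eqP; rewrite eq_le.
have := max_principle adj tree (Hx 1) (lift ord0 k).
have := max_principle adj tree (Hx (-1)) (lift ord0 k).
by rewrite /with_leader liftK unlift_none mulN1r mul1r oppr_le0 => -> ->.
Qed.

Lemma spectrum_Hmx_pos N (edge : rel 'I_N.+1) (a : 'M[R]_N.+1) :
  weighted_adjacency edge a -> has_spanning_tree_from edge ord0 ->
  forall l, spectrum (Hmx a) l -> 0 < complex.Re l.
Proof.
move=> adj tree l Hl; have [aii apos a0] := adj.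
have age0 i j : 0 <= a i j by have [/apos/ltW//|/a0->] := boolP (edge j i).
apply: spectrum_diag_dominant (Hl) _ => [i|].
  rewrite mxE eqxx big_ord_recl -[leLHS]add0r lerD//.
  rewrite [leRHS](bigD1 i)//= -[leLHS]add0r lerD//.
  by apply: ler_sum => j ji; rewrite mxE eq_sym (negPf ji) normrN ger0_norm.
apply: contra (det_Hmx_neq0 adj tree) => /eqP l0.
move: Hl => /eigenvalueP[v]; rewrite l0 scale0r => Hv v0.
rewrite -(fmorph_eq0 (real_complex R)) -det_map_mx; apply/det0P.
by exists v.
Qed.

(** The standard vec identity, which turns Kronecker-product systems into matrix equations. *)
Lemma tensmx_vec m n p q (M : 'M[R]_(m, n)) (S : 'M[R]_(p, q)) (Y : 'M[R]_(q, n)) :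
  (M *t S) *m vec Y = vec (S *m Y *m M^T).
Proof.
apply/matrixP => k j; case: (mxtens_indexP k) => i k'; rewrite !mxE mxtens_indexK /=.
rewrite (reindex (@mxtens_index n q)) /=; last first.
  by exists (@mxtens_unindex n q) => ? _; rewrite ?mxtens_indexK ?mxtens_unindexK.
under eq_bigr => ij _ do rewrite mxE [vec Y _ _]mxE !mxtens_indexK /=.
rewrite -(pair_bigA _ (fun j l => M i j * S k' l * Y l j)) /=.
apply: eq_bigr => c _; rewrite !mxE mulr_suml; apply: eq_bigr => l _.
by rewrite mulrC mulrA mulrC mulrA.
Qed.

End Network.

(** * The regulator equations *)

Section Regulator.
Variable R : realType.

Lemma unvecK n q : cancel (@unvec R n q) (@vec R n q).
Proof.
move=> z; apply/colP => k; case: (mxtens_indexP k) => j i.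
by rewrite !mxE mxtens_indexK.
Qed.

Lemma vecK n q : cancel (@vec R n q) (@unvec R n q).
Proof. by move=> Y; apply/matrixP => i j; rewrite !mxE mxtens_indexK. Qed.

Lemma vecB n q (Y Z : 'M[R]_(n, q)) : vec (Y - Z) = vec Y - vec Z.
Proof. by apply/matrixP => i j; rewrite !mxE. Qed.

Lemma vecD n q (Y Z : 'M[R]_(n, q)) : vec (Y + Z) = vec Y + vec Z.
Proof. by apply/matrixP => i j; rewrite !mxE. Qed.

Lemma vecZ n q (c : R) (Y : 'M[R]_(n, q)) : vec (c *: Y) = c *: vec Y.
Proof. by apply/matrixP => i j; rewrite !mxE. Qed.

Lemma unvecB n q (y z : 'cV[R]_(q * n)) : unvec (y - z) = unvec y - unvec z.
Proof. by apply/matrixP => i j; rewrite !mxE. Qed.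

Section RegulatorMatrix.
Variables (q n m : nat) (S : 'M[R]_q) (A : 'M[R]_n) (B : 'M[R]_(n, m)).
Variables (C : 'M[R]_(m, n)) (D : 'M[R]_m).

Lemma regulator_mx_vec (X : 'M[R]_(n, q)) (U : 'M[R]_(m, q)) :
  regulator_mx S A B C D *m vec (col_mx X U) =
  vec (col_mx (X *m S - (A *m X + B *m U)) (- (C *m X + D *m U))).
Proof.
rewrite mulmxBl !tensmx_vec -vecB trmxK trmx1 mulmx1 !mul_block_col.
by rewrite mul1mx !mul0mx !addr0 mul_col_mx mul0mx opp_col_mx add_col_mx sub0r.
Qed.

Lemma regulator_mx_sol (E : 'M[R]_(n, q)) (F : 'M[R]_(m, q))
    (X : 'M[R]_(n, q)) (U : 'M[R]_(m, q)) :
  X *m S = A *m X + B *m U + E -> 0 = C *m X + D *m U + F ->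
  regulator_mx S A B C D *m vec (col_mx X U) = regulator_rhs E F.
Proof.
move=> XS CX; rewrite regulator_mx_vec /regulator_rhs XS addrAC subrr add0r.
by congr (vec (col_mx _ _)); apply/eqP; rewrite eq_sym -addr_eq0 addrC -CX.
Qed.

(** A nonzero kernel vector, unstacked into a pair [(X', U')], could be added to the solution,
    contradicting uniqueness. *)
Lemma regulator_mx_unit (E : 'M[R]_(n, q)) (F : 'M[R]_(m, q)) :
  (exists! XU : 'M[R]_(n, q) * 'M[R]_(m, q),
      XU.1 *m S = A *m XU.1 + B *m XU.2 + E /\
      0 = C *m XU.1 + D *m XU.2 + F) ->
  regulator_mx S A B C D \in unitmx.
Proof.
move=> [[X U] [[/= XS CX] uniqXU]].
rewrite unitmxE unitfE -det_tr; apply/det0P => -[z z0 Qz].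
set Y := unvec z^T; pose X' := usubmx Y; pose U' := dsubmx Y.
have zE : z^T = vec (col_mx X' U') by rewrite vsubmxK unvecK.
have : regulator_mx S A B C D *m z^T = 0.
  by rewrite -[LHS]trmxK trmx_mul trmxK Qz trmx0.
rewrite zE regulator_mx_vec => /(congr1 (@unvec R _ _)); rewrite vecK.
rewrite (_ : unvec 0 = col_mx 0 0); last by apply/matrixP => i j; rewrite col_mx0 !mxE.
move=> /eq_col_mx[/eqP]; rewrite subr_eq0 => /eqP XS' /eqP; rewrite oppr_eq0 => /eqP CX'.
have /(uniqXU (X + X', U + U'))[XX UU] :
    (X + X') *m S = A *m (X + X') + B *m (U + U') + E /\
    0 = C *m (X + X') + D *m (U + U') + F.
  rewrite mulmxDl !mulmxDr XS XS'; split.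
    by rewrite [in RHS]addrACA [RHS]addrAC.
  by rewrite [in RHS]addrACA CX' addr0 -CX.
have X'0 : X' = 0 by apply: (addrI X); rewrite addr0 -XX.
have U'0 : U' = 0 by apply: (addrI U); rewrite addr0 -UU.
case/negP: z0; rewrite -[z]trmxK zE X'0 U'0 col_mx0; apply/eqP/matrixP => i j.
by rewrite !mxE.
Qed.

Lemma regulator_mxB (S' : 'M[R]_q) :
  regulator_mx S' A B C D - regulator_mx S A B C D =
  (S' - S)^T *t block_mx 1%:M 0 0 0.
Proof.
by rewrite opprB addrA subrK linearB /=; apply/matrixP => i j; rewrite !mxE mulrBl.
Qed.

Lemma decays_regulator_mx (Sh : nat -> 'M[R]_q) :
  decays (fun t => Sh t - S) ->
  decays (fun t => regulator_mx (Sh t) A B C D - regulator_mx S A B C D).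
Proof.
move=> HS; under eq_fun do rewrite regulator_mxB.
set K := block_mx _ _ _ _; move: HS; apply: (@decays_le _ _ _ `|K|) => // t.
apply: mx_norm_le => [|i j]; first by rewrite mulr_ge0.
by rewrite mxE normrM mulrC ler_pM// ?norm_entry_le// mxE norm_entry_le.
Qed.

End RegulatorMatrix.
End Regulator.

(** * The closed loop *)

Section ClosedLoop.
Variable R : realType.

Lemma leader_matrix_observer N q (edge : rel 'I_N.+1) (a : 'M[R]_N.+1)
    (S : 'M[R]_q) (mu : R) (Sh : 'I_N -> nat -> 'M[R]_q) :
  weighted_adjacency edge a -> has_spanning_tree_from edge ord0 ->
  0 < mu < 2 / rho (Hmx a) ->
  (forall t i, Sh i t.+1 = Sh i t + mu *: \sum_(j < N.+1)
     a (lift ord0 i) j *: (with_leader S (Sh^~ t) j - Sh i t)) ->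
  forall i, decays (fun t => Sh i t - S).
Proof.
move=> adj tree mu_bounds HSh i; have [aii _ _] := adj.
have FS := Schur_one_subZ (spectrum_Hmx_pos adj tree) mu_bounds.
apply: decays_entries => k l.
pose s t : 'cV[R]_N := \col_j (Sh j t - S) k l.
have Hs : decays s.
  apply: (Schur_perturbed FS (decays_cst0 _) (decays_cst0 _)) => t.
  rewrite !addr0; apply/colP => j; rewrite mulmxBl mul1mx -scalemxAl.
  rewrite !mxE HSh consensus_errorE// !mxE summxE addrAC.
  by congr (_ + _); rewrite mulrN; congr (- (_ * _)); apply: eq_bigr => c _; rewrite !mxE.
by have := decays_entry i 0 Hs; under eq_fun do rewrite mxE.
Qed.

Lemma mul_delta_diagE m N (M : 'M[R]_(m, N)) (j i : 'I_N) k :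
  (M *m delta_mx j j) k i = if j == i then M k i else 0.
Proof.
rewrite mxE (bigD1 j)//= big1 ?addr0 => [|c /negPf cj]; last by rewrite mxE cj mulr0.
by rewrite mxE eqxx eq_sym; case: eqP => [->|_]; rewrite ?mulr1 ?mulr0.
Qed.

(** Lets each follower's own matrix act on its own column of the stacked errors within one matrix
    expression. *)
Lemma sum_delta_diagE m N (M : 'I_N -> 'M[R]_(m, N)) k i :
  (\sum_j M j *m delta_mx j j) k i = M i k i.
Proof.
rewrite summxE (bigD1 i)//= mul_delta_diagE eqxx big1 ?addr0// => j /negPf ji.
by rewrite mul_delta_diagE ji.
Qed.

(** With the errors as columns of [Y], vectorization gives a system driven by the assumed Schur
    matrix. Its perturbations all carry a factor [Sh j t - S], whose decay outweighs the growth of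
    [v]. *)
Lemma leader_state_observer N q (a : 'M[R]_N.+1) (S : 'M[R]_q) (mu : R)
    (v : nat -> 'cV[R]_q) (Sh : 'I_N -> nat -> 'M[R]_q)
    (eta : 'I_N -> nat -> 'cV[R]_q) :
  (forall i, a i i = 0) -> is_Schur (1%:M *t S - mu *: (Hmx a *t S)) ->
  subexp v -> (forall t, v t.+1 = S *m v t) ->
  (forall i, decays (fun t => Sh i t - S)) ->
  (forall t i, eta i t.+1 = Sh i t *m eta i t + mu *: (Sh i t *m
     \sum_(j < N.+1) a (lift ord0 i) j *: (with_leader (v t) (eta^~ t) j - eta i t))) ->
  forall i, decays (fun t => eta i t - v t).
Proof.
move=> aii FS v_subexp Hv HSh Heta i.
pose Y t : 'M[R]_(q, N) := \matrix_(k, j) (eta j t - v t) k 0.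
pose Z t := Y t - mu *: (Y t *m (Hmx a)^T).
(* [v t *m J] repeats the leader state in each follower's column, and [W0] below is block diagonal
   with blocks [Sh j t - S]. *)
pose J : 'rV[R]_N := const_mx 1.
pose W0 t : 'M[R]_(N * q) := \sum_j delta_mx j j *t (Sh j t - S).
have W0_decays : decays W0.
  apply: decays_sum => j; move: (HSh j).
  apply: (@decays_le _ _ _ `|delta_mx j j : 'M[R]_N|) => // t.
  apply: mx_norm_le => [|k l]; first by rewrite mulr_ge0.
  by rewrite mxE normrM ler_pM// norm_entry_le.
have W0_vec t (M : 'M[R]_(q, N)) :
    W0 t *m vec M = vec (\sum_j (Sh j t - S) *m M *m delta_mx j j).
  rewrite mulmx_suml; apply/matrixP => k l; rewrite summxE mxE summxE.
  by apply: eq_bigr => j _; rewrite tensmx_vec trmx_delta mxE.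
have YS t : Y t.+1 = S *m Z t + \sum_j (Sh j t - S) *m (Z t + v t *m J) *m delta_mx j j.
  apply/matrixP => k j; rewrite [RHS]mxE sum_delta_diagE mxE.
  set p := \sum_c Hmx a j c *: (eta c t - v t).
  have Zp l : Z t l j = (eta j t - v t - mu *: p) l 0.
    rewrite !mxE; congr (_ - _ * _); rewrite summxE.
    by apply: eq_bigr => c _; rewrite !mxE mulrC.
  (* Writing [Sh j t] as [S + (Sh j t - S)] separates the nominal dynamics from the perturbation,
     where [eta] is then split into its error and [v]. *)
  have -> : eta j t.+1 - v t.+1 =
      S *m (eta j t - v t - mu *: p) + (Sh j t - S) *m (eta j t - mu *: p).
    rewrite Heta consensus_errorE// Hv -/p mulmxN scalerN scalemxAr.
    rewrite !mulmxBr !mulmxBl.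
    move: (S *m _) (S *m _) (S *m _) (Sh j t *m _) (Sh j t *m _) => c1 c2 c3 c4 c5.
    by apply/matrixP => x y; rewrite !mxE; ring.
  rewrite mxE; congr (_ + _); first by rewrite !mxE; apply: eq_bigr => l _; rewrite -Zp.
  rewrite !mxE; apply: eq_bigr => l _; rewrite [(Z t + _) _ _]mxE Zp.
  by congr (_ * _); rewrite !mxE big_ord1 !mxE mulr1; ring.
have Ydec : decays (fun t => vec (Y t)).
  apply: (@Schur_perturbed _ _ _ _
    (fun t => W0 t *m (1%:M - mu *: (Hmx a *t 1%:M)))
    (fun t => W0 t *m vec (v t *m J)) _ FS).
  - by apply: decays_mulmx => //; exact: subexp_cst.
  - apply: decays_mulmx => //.
    apply: (@subexp_le _ _ _ 1 _ v) => // t; rewrite mul1r.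
    apply: mx_norm_le => // k l; rewrite !mxE big_ord1 !mxE mulr1.
    exact: norm_entry_le.
  - move=> t; rewrite YS vecD -W0_vec [vec (Z t + _)]vecD.
    rewrite [W0 t *m (vec (Z t) + _)]mulmxDr mulmxDl addrA; congr (_ + _ + _).
      rewrite mulmxBl -scalemxAl !tensmx_vec trmx1 mulmx1 -vecZ -vecB.
      by rewrite /Z mulmxBr -scalemxAr mulmxA.
    rewrite -mulmxA; congr (_ *m _); rewrite mulmxBl mul1mx -scalemxAl tensmx_vec.
    by rewrite mul1mx -vecZ -vecB.
apply: decays_entries => k l.
have := decays_entry (mxtens_index (i, k)) l Ydec; congr decays.
by apply/funext => t; rewrite !mxE mxtens_indexK (ord1 l).
Qed.

(** The nominal matrix is [1 - mu Q^T Q]. The defect [G^T G - Q^T Q = (G - Q)^T G + Q^T (G - Q)]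
    decays, and substituting [b = Q z] leaves the decaying forcing [G^T (G - Q) z]. *)
Lemma gradient_regulator_solver n (G : nat -> 'M[R]_n) (Q : 'M[R]_n)
    (mu : R) (b z : 'cV[R]_n) (zeta : nat -> 'cV[R]_n) :
  Q \in unitmx -> 0 < mu < 2 / rho (Q^T *m Q) ->
  decays (fun t => G t - Q) -> Q *m z = b ->
  (forall t, zeta t.+1 = zeta t - mu *: ((G t)^T *m (G t *m zeta t - b))) ->
  decays (fun t => zeta t - z).
Proof.
move=> Qu mu_bounds GQ Qz Hzeta.
have FS := Schur_one_subZ (spectrum_gram_pos Qu) mu_bounds.
have G_subexp : subexp G.
  have -> : G = fun t => Q + (G t - Q) by apply/funext => t; rewrite addrC subrK.
  by apply: subexpD; [exact: subexp_cst|exact: decays_subexp].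
have GT_subexp : subexp (fun t => (G t)^T).
  apply: (@subexp_le _ _ _ 1 _ G) => // t; rewrite mul1r.
  by apply: mx_norm_le => // i j; rewrite mxE norm_entry_le.
apply: (@Schur_perturbed _ _ _ _
  (fun t => (- mu) *: ((G t - Q)^T *m G t + Q^T *m (G t - Q)))
  (fun t => (- mu) *: ((G t)^T *m ((G t - Q) *m z))) _ FS).
- apply: decaysZ; apply: decaysD.
    by apply: decays_mulmx => //; exact: decays_trmx.
  by apply: decays_mulmxr => //; exact: subexp_cst.
- apply: decaysZ; apply: decays_mulmxr => //.
  by apply: decays_mulmx => //; exact: subexp_cst.
- move=> t; rewrite Hzeta -Qz.
  have -> : 1%:M - mu *: (Q^T *m Q) + - mu *: ((G t - Q)^T *m G t + Q^T *m (G t - Q))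
      = 1%:M - mu *: ((G t)^T *m G t).
    rewrite linearB/= mulmxBl mulmxBr.
    move: 1%:M (Q^T *m Q) (Q^T *m G t) ((G t)^T *m G t) => c1 c2 c3 c4.
    by apply/matrixP => x y; rewrite !mxE; ring.
  rewrite mulmxBl mul1mx -scalemxAl !mulmxBr [(G t - Q) *m z]mulmxBl mulmxBr -!mulmxA.
  move: (_ *m (G t *m zeta t)) (_ *m (Q *m z)) (_ *m (G t *m z)) => c1 c2 c3.
  by apply/matrixP => x y; rewrite !mxE; ring.
Qed.

(** Relative to the steady state [X v], the input is [K (x - X v) + U v] plus a decaying defect [d],
    and the regulator equations cancel every term in [v] from both the state error and the
    output. *)
Lemma tracking_error n m q (A : 'M[R]_n) (B : 'M[R]_(n, m)) (C : 'M[R]_(m, n))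
    (D : 'M[R]_m) (E : 'M[R]_(n, q)) (F : 'M[R]_(m, q)) (K : 'M[R]_(m, n))
    (S : 'M[R]_q) (X : 'M[R]_(n, q)) (U : 'M[R]_(m, q)) (v eta : nat -> 'cV[R]_q)
    (x : nat -> 'cV[R]_n) (u e : nat -> 'cV[R]_m) (Ke : nat -> 'M[R]_(m, q)) :
  is_Schur (A + B *m K) ->
  X *m S = A *m X + B *m U + E -> 0 = C *m X + D *m U + F ->
  subexp v -> (forall t, v t.+1 = S *m v t) ->
  decays (fun t => eta t - v t) -> decays (fun t => Ke t - (U - K *m X)) ->
  (forall t, x t.+1 = A *m x t + B *m u t + E *m v t) ->
  (forall t, u t = K *m x t + Ke t *m eta t) ->
  (forall t, e t = C *m x t + D *m u t + F *m v t) ->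
  decays (fun t => x t - X *m v t) /\ decays e.
Proof.
move=> FS XS CX v_subexp Hv eta_v KeU Hx Hu He.
pose Ks := U - K *m X.
pose d t := Ke t *m (eta t - v t) + (Ke t - Ks) *m v t.
have d_decays : decays d.
  apply: decaysD; last exact: decays_mulmx.
  apply: decays_mulmxr => //.
  have -> : Ke = fun t => Ks + (Ke t - Ks) by apply/funext => t; rewrite addrC subrK.
  by apply: subexpD; [exact: subexp_cst|exact: decays_subexp].
have uE t : u t = K *m (x t - X *m v t) + d t + U *m v t.
  rewrite Hu /d mulmxBr [Ke t *m (_ - _)]mulmxBr mulmxBl [Ks *m _]mulmxBl -!mulmxA.
  move: (K *m x t) (K *m _) (Ke t *m eta t) (Ke t *m v t) (U *m v t) => c1 c2 c3 c4 c5.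
  by apply/matrixP => i j; rewrite !mxE; ring.
have x_decays : decays (fun t => x t - X *m v t).
  apply: (@Schur_perturbed _ _ _ _ (fun=> 0) (fun t => B *m d t) _ FS).
  - exact: decays_cst0.
  - by apply: decays_mulmxr => //; exact: subexp_cst.
  move=> t; rewrite addr0 Hx Hv uE mulmxA XS !mulmxDl !mulmxDr !mulmxN !mulmxA.
  move: (A *m x t) (B *m K *m x t) (A *m X *m v t) (B *m K *m X *m v t) => c1 c2 c3 c4.
  move: (B *m d t) (B *m U *m v t) (E *m v t) => c5 c6 c7.
  by apply/matrixP => i j; rewrite !mxE; ring.
split=> //.
have -> : e = fun t => (C + D *m K) *m (x t - X *m v t) + D *m d t.
  apply/funext => t.
  have : (C *m X + D *m U + F) *m v t = 0 by rewrite -CX mul0mx.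
  rewrite He uE !mulmxDl !mulmxDr !mulmxN !mulmxA.
  move: (C *m x t) (D *m K *m x t) (C *m X *m v t) (D *m K *m X *m v t) => c1 c2 c3 c4.
  move: (D *m d t) (D *m U *m v t) (F *m v t) => c5 c6 c7 /matrixP H.
  by apply/matrixP => i j; have := H i j; rewrite !mxE; lra.
by apply: decaysD; apply: decays_mulmxr => //; exact: subexp_cst.
Qed.

End ClosedLoop.

(** * Existence of the closed-loop trajectory *)

Section Existence.
Variables (R : realType) (N q : nat) (n m : 'I_N -> nat).

(** Only the components with dynamics: input and output are static functions of these, so iterating
    one step map generates the trajectory. *)
Record loop_state := LoopState {
  st_v : 'cV[R]_q;
  st_x : forall i, 'cV[R]_(n i);
  st_S : 'I_N -> 'M[R]_q;
  st_eta : 'I_N -> 'cV[R]_q;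
  st_zeta : forall i, 'cV[R]_(q * (n i + m i))
}.

Lemma closed_loop_exists (S : 'M[R]_q)
    (A : forall i, 'M[R]_(n i)) (B : forall i, 'M[R]_(n i, m i))
    (C : forall i, 'M[R]_(m i, n i)) (D : forall i, 'M[R]_(m i))
    (E : forall i, 'M[R]_(n i, q)) (F : forall i, 'M[R]_(m i, q))
    (a : 'M[R]_N.+1) (mu1 mu2 : R) (mu3 : 'I_N -> R)
    (Kx : forall i, 'M[R]_(m i, n i)) (s0 : loop_state) :
  exists tr : trajectory R q n m,
    [/\ plant S A B C D E F tr,
        controller S A B C D E F a mu1 mu2 mu3 Kx tr,
        tr_v tr 0%N = st_v s0
      & forall i, [/\ tr_x tr i 0%N = st_x s0 i, tr_S tr i 0%N = st_S s0 i,
          tr_eta tr i 0%N = st_eta s0 i & tr_zeta tr i 0%N = st_zeta s0 i]].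
Proof.
pose u s i := Kx i *m st_x s i +
  (dsubmx (unvec (st_zeta s i)) - Kx i *m usubmx (unvec (st_zeta s i)))
    *m st_eta s i.
pose e s i := C i *m st_x s i + D i *m u s i + F i *m st_v s.
pose w i := a (lift ord0 i).
pose S' s i := st_S s i +
  mu1 *: \sum_(j < N.+1) w i j *: (with_leader S (st_S s) j - st_S s i).
pose eta' s i := st_S s i *m st_eta s i + mu2 *: (st_S s i *m
  \sum_(j < N.+1) w i j *: (with_leader (st_v s) (st_eta s) j - st_eta s i)).
pose G s i := regulator_mx (st_S s i) (A i) (B i) (C i) (D i).
pose zeta' s i := st_zeta s i -
  mu3 i *: ((G s i)^T *m (G s i *m st_zeta s i - regulator_rhs (E i) (F i))).
pose step s := LoopState (S *m st_v s)
  (fun i => A i *m st_x s i + B i *m u s i + E i *m st_v s) (S' s) (eta' s) (zeta' s).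
pose s t := iter t step s0.
by exists (Trajectory (fun t => st_v (s t)) (fun i t => st_x (s t) i)
  (fun i t => u (s t) i) (fun i t => e (s t) i) (fun i t => st_S (s t) i)
  (fun i t => st_eta (s t) i) (fun i t => st_zeta (s t) i)).
Qed.

End Existence.

(** * Boundedness and regulation of the closed loop *)

Lemma bounded_fun_norm_leP (R : realType) (V : normedModType R) (f : nat -> V) :
  (exists c, forall t, `|f t| <= c) <-> bounded_fun f.
Proof.
have PF : ProperFilter (globally [set: nat]) by exact: (@globally_properfilter _ _ 0%N I).
split=> [[c Hc]|/(ex_bound f)[c Hc]].
  by apply/(ex_bound f); exists c => t _ /=; exact: Hc.
by exists c => t; exact: Hc.
Qed.

Lemma bounded_fun_decays (R : realType) (V : normedModType R) (f g : nat -> V) :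
  bounded_fun g -> decays (fun t => f t - g t) -> bounded_fun f.
Proof.
move=> /bounded_fun_norm_leP[c Hc] /decays_bounded[d Hd].
apply/bounded_fun_norm_leP; exists (d + c) => t.
by rewrite -[f t](subrK (g t)) (le_trans (ler_normD _ _))// lerD.
Qed.

Theorem theorem1 (R : realType) (N q : nat) (n m : 'I_N -> nat)
  (S : 'M[R]_q)
  (A : forall i, 'M[R]_(n i)) (B : forall i, 'M[R]_(n i, m i))
  (C : forall i, 'M[R]_(m i, n i)) (D : forall i, 'M[R]_(m i))
  (E : forall i, 'M[R]_(n i, q)) (F : forall i, 'M[R]_(m i, q))
  (edge : rel 'I_N.+1) (a : 'M[R]_N.+1)
  (a_adj : weighted_adjacency edge a)
  (S_le1 : forall l, spectrum S l -> Normc.normc l <= 1)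
  (AB_stab : forall i, stabilizable (A i) (B i))
  (reg_eq : forall i, exists! XU : 'M[R]_(n i, q) * 'M[R]_(m i, q),
      XU.1 *m S = A i *m XU.1 + B i *m XU.2 + E i /\
      0 = C i *m XU.1 + D i *m XU.2 + F i)
  (tree : has_spanning_tree_from edge ord0)
  (mu1 mu2 : R) (mu3 : 'I_N -> R)
  (mu1_bounds : 0 < mu1 < 2 / rho (Hmx a))
  (mu2_gt0 : 0 < mu2)
  (mu2_Schur : is_Schur (1%:M *t S - mu2 *: (Hmx a *t S)))
  (mu3_bounds : forall i,
      let Q := regulator_mx S (A i) (B i) (C i) (D i) in
      0 < mu3 i < 2 / rho (Q^T *m Q))
  (Kx : forall i, 'M[R]_(m i, n i))
  (Kx_Schur : forall i, is_Schur (A i + B i *m Kx i))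
  (v0 : 'cV[R]_q) (x0 : forall i, 'cV[R]_(n i))
  (S0 : 'I_N -> 'M[R]_q) (eta0 : 'I_N -> 'cV[R]_q)
  (zeta0 : forall i, 'cV[R]_(q * (n i + m i))) :
  let closed_loop (tr : trajectory R q n m) :=
    [/\ plant S A B C D E F tr,
        controller S A B C D E F a mu1 mu2 mu3 Kx tr,
        tr_v tr 0%N = v0
      & forall i, [/\ tr_x tr i 0%N = x0 i, tr_S tr i 0%N = S0 i,
                      tr_eta tr i 0%N = eta0 i & tr_zeta tr i 0%N = zeta0 i]] in
  (exists tr, closed_loop tr) /\
  forall tr, closed_loop tr ->
    (bounded_fun (tr_v tr) ->
       forall i, [/\ bounded_fun (tr_x tr i), bounded_fun (tr_S tr i),
                     bounded_fun (tr_eta tr i) & bounded_fun (tr_zeta tr i)]) /\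
    (forall i, tr_e tr i @ \oo --> (0 : 'cV[R]_(m i))).
Proof.
split; first exact: (closed_loop_exists S A B C D E F a mu1 mu2 mu3 Kx
  (LoopState v0 x0 S0 eta0 zeta0)).
move=> tr [Hplant Hctrl _ _].
set v := tr_v tr.
have Hv t : v t.+1 = S *m v t by have [] := Hplant t.
have v_subexp : subexp v := subexp_iter S_le1 Hv.
have [aii _ _] := a_adj.
have S_decays : forall i, decays (fun t => tr_S tr i t - S).
  by apply: (leader_matrix_observer a_adj tree mu1_bounds) => t i; have [] := Hctrl t i.
have eta_decays : forall i, decays (fun t => tr_eta tr i t - v t).
  apply: (leader_state_observer aii mu2_Schur v_subexp Hv S_decays) => t i.
  by have [] := Hctrl t i.
(* Each follower's targets are packed existentially: the decay towards them yields boundedness, and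
   the decay of the output yields regulation. *)
have decays_i i : exists z, [/\ decays (fun t => tr_zeta tr i t - z),
    exists X, decays (fun t => tr_x tr i t - X *m v t) & decays (tr_e tr i)].
  have Qu := regulator_mx_unit (reg_eq i).
  have [[X U] [[/= XS CX] _]] := reg_eq i.
  have zeta_decays := gradient_regulator_solver Qu (mu3_bounds i)
    (decays_regulator_mx (A i) (B i) (C i) (D i) (S_decays i))
    (regulator_mx_sol XS CX) (fun t => let: And4 _ _ _ H := Hctrl t i in H).
  exists (vec (col_mx X U)).
  pose Z t := unvec (tr_zeta tr i t).
  have Z_decays : decays (fun t => Z t - col_mx X U).
    apply: decays_entries => k l; apply: (@decays_le _ _ _ 1 _ _ ler01 _ zeta_decays).
    move=> t; have -> : Z t - col_mx X U = unvec (tr_zeta tr i t - vec (col_mx X U)).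
      by rewrite unvecB vecK.
    by rewrite mul1r mxE; exact: norm_entry_le.
  pose Ke t := dsubmx (Z t) - Kx i *m usubmx (Z t).
  have Ke_decays : decays (fun t => Ke t - (U - Kx i *m X)).
    (* The gain is a fixed linear image of the stacked solution estimate, so its error inherits the
       decay. *)
    have -> : (fun t => Ke t - (U - Kx i *m X)) =
        fun t => row_mx (- Kx i) 1%:M *m (Z t - col_mx X U).
      apply/funext => t; rewrite -[Z t]vsubmxK opp_col_mx add_col_mx mul_row_col.
      rewrite /Ke mul1mx mulNmx mulmxBr; move: (_ *m _) (_ *m _) => c1 c2.
      by apply/matrixP => k l; rewrite !mxE; ring.
    by apply: decays_mulmxr => //; exact: subexp_cst.
  have Hx t : tr_x tr i t.+1 = A i *m tr_x tr i t + B i *m tr_u tr i t + E i *m v t.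
    by have [_ ->] := Hplant t.
  have Hu t : tr_u tr i t = Kx i *m tr_x tr i t + Ke t *m tr_eta tr i t.
    by have [->] := Hctrl t i.
  have He t : tr_e tr i t = C i *m tr_x tr i t + D i *m tr_u tr i t + F i *m v t.
    by have [_ _ ->] := Hplant t.
  have [? ?] := tracking_error (Kx_Schur i) XS CX v_subexp Hv (eta_decays i)
    Ke_decays Hx Hu He.
  by split=> //; exists X.
split=> [v_bounded i|i]; last by have [z [_ _ /decays_cvg]] := decays_i i.
have [z [zeta_z [X xX] _]] := decays_i i; split.
- apply: bounded_fun_decays xX; apply/bounded_fun_norm_leP.
  have /bounded_fun_norm_leP[c Hc] := v_bounded.
  exists (q%:R * `|X| * c) => t; apply: le_trans (norm_mulmx_le _ _) _.
  by rewrite ler_wpM2l ?mulr_ge0.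
- by apply: bounded_fun_decays (S_decays i); exact: bounded_cst.
- exact: bounded_fun_decays (eta_decays i).
- by apply: bounded_fun_decays zeta_z; exact: bounded_cst.
Qed.
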